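(* Let $\mathrm{CAL}$ be an arbitrary unnormalized binned squared error (UBSE). For every positive integer $T$, any report sequence $\boldsymbol r=(r_1,\ldots,r_T)\in[0,1]^T$ and any ground-truth vector $\boldsymbol p=(p_1,\ldots,p_T)\in[0,1]^T$, $$\mathbb E_{\boldsymbol y\sim\boldsymbol p}[\mathrm{CAL}(\boldsymbol r,\boldsymbol y)]=\mathrm{CAL}(\boldsymbol r,\boldsymbol p)+\frac1{T^2}\sum_{t=1}^T p_t(1-p_t).$$
   Context: Notation: $\boldsymbol y\sim\boldsymbol p$ means that $\boldsymbol y=(y_1,\ldots,y_T)\in\{0,1\}^T$ has independent coordinates, $y_t$ being Bernoulli with mean $p_t$. $[T]=\{1,\ldots,T\}$. UBSE: an error metric $\mathrm{CAL}(\boldsymbol r,\boldsymbol p)$, taking as input a report vector $\boldsymbol r=(r_1,\ldots,r_T)\in[0,1]^T$ and a vector $\boldsymbol p=(p_1,\ldots,p_T)\in[0,1]^T$ (which may in particular be a vector in $\{0,1\}^T$), is called an unnormalized binned squared error if it is computed as follows. (1) Partition the index set into $k$ disjoint bins, $[T]=B_1\cup\cdots\cup B_k$; the partition $\mathcal B=(B_1,\ldots,B_k)$ (including $k$) may be randomized, and its distribution may depend arbitrarily on $\boldsymbol r$ but not on $\boldsymbol p$. (2) Put $\Delta_i:=\frac1T\sum_{t\in B_i}(r_t-p_t)$ for each $i$. (3) $\mathrm{CAL}(\boldsymbol r,\boldsymbol p):=\mathbb E_{\mathcal B}\left[\sum_{i=1}^k\Delta_i^2\right]$, where the expectation is over the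 randomness of the partition $\mathcal B$. *)

(* Defs.v *)
From HB Require Import structures.
From mathcomp Require Import all_boot all_order all_algebra.
From mathcomp Require Import all_classical all_reals all_analysis.

Set Implicit Arguments.
Unset Strict Implicit.
Unset Printing Implicit Defensive.

Import Order.TTheory GRing.Theory Num.Theory.
Import numFieldNormedType.Exports.

Local Open Scope classical_set_scope.
Local Open Scope ring_scope.

Definition unit_vector (R : realType) (T : nat) (v : 'I_T -> R) : Prop :=
  forall t, 0 <= v t <= 1.

(* (B_1, ..., B_k) with k = size B.  Bins may be empty; an empty bin contributes
   0 to the binned error. *)
Definition is_binning (T : nat) (B : seq {set 'I_T}) : bool :=
  pairwise (fun b c : {set 'I_T} => b :&: c == finset.set0) B
  && (\bigcup_(b <- B) b == [set: 'I_T])%SET.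

Definition bin_bias (R : realType) (T : nat) (r p : 'I_T -> R)
    (b : {set 'I_T}) : R :=
  T%:R^-1 * \sum_(t in b) (r t - p t).

Definition binned_sqerr (R : realType) (T : nat) (r p : 'I_T -> R)
    (B : seq {set 'I_T}) : R :=
  \sum_(b <- B) bin_bias r p b ^+ 2.

(* The probability space and the random partition B on it are chosen after r
   and before p.  B is a random element of the countable set of bin sequences,
   equipped with the discrete sigma-algebra.  Values of CAL outside [0,1]^T are
   unconstrained. *)
Definition is_UBSE (R : realType)
    (CAL : forall T : nat, ('I_T -> R) -> ('I_T -> R) -> R) : Prop :=
  forall (T : nat) (r : 'I_T -> R), (0 < T)%N -> unit_vector r ->
  exists (d : measure_display) (Omega : measurableType d)
         (P : probability Omega R) (B : Omega -> seq {set 'I_T}),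
  [/\ forall S : set (seq {set 'I_T}), measurable (B @^-1` S),
      forall w, is_binning (B w)
    & forall p : 'I_T -> R, unit_vector p ->
        (CAL T r p)%:E = 'E_P[fun w => binned_sqerr r p (B w)]%E ].

Definition mutually_independent (R : realType) (d d' : measure_display)
    (Omega : measurableType d) (E : measurableType d')
    (P : probability Omega R) (I : finType) (X : I -> {RV P >-> E}) : Prop :=
  forall (J : {set I}) (A : I -> set E), (forall i, measurable (A i)) ->
    P (\bigcap_(i in [set` J]) (X i @^-1` A i)) =
    (\prod_(i in J) P (X i @^-1` A i))%E.

(* y ~ p, for a random vector y in {0,1}^T encoded with boolean coordinates. *)
Definition bernoulli_vector (R : realType) (d : measure_display)
    (Omega : measurableType d) (P : probability Omega R) (T : nat)
    (p : 'I_T -> R) (y : 'I_T -> {RV P >-> bool}) : Prop :=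
  mutually_independent y /\
  forall t, distribution P (y t) =1 bernoulli_prob (p t).

(* Main.v *)
(** For a fixed report r, averaging over the partition turns CAL(r, p) into a
    quadratic form T^-2 sum_{s,t} M_{st} (r_s - p_s)(r_t - p_t), where M_{st} is
    the probability that s and t share a bin, so M_{tt} = 1.  Replacing p by an
    independent Bernoulli vector of mean p preserves the expectation of the
    off-diagonal products and adds the variance p_t (1 - p_t) to the diagonal
    ones. *)
Require Import Defs.
From HB Require Import structures.
From mathcomp Require Import all_boot all_order all_algebra.
From mathcomp Require Import all_classical all_reals all_analysis.
From mathcomp Require Import ring.
Import Order.TTheory GRing.Theory Num.Theory.
Import numFieldNormedType.Exports.
Local Open Scope classical_set_scope.
Local Open Scope ring_scope.

Set Implicit Arguments.
Unset Strict Implicit.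

(** Both the random partition and [y] enter only through finitely many events, so this reduces every
    expectation below to a finite sum of probabilities. *)
Lemma expectation_sum_indic (R : realType) (d : measure_display)
    (Omega : measurableType d) (P : probability Omega R) (I : finType)
    (a : I -> R) (A : I -> set Omega) :
  (forall i, measurable (A i)) ->
  'E_P[fun w => (\sum_i a i * \1_(A i) w)%R]%E = (\sum_i a i * fine (P (A i)))%:E.
Proof.
move=> mA; rewrite unlock.
under eq_integral do rewrite -sumEFin.
rewrite integral_sum//= => [|i]; last first.
  under eq_fun do rewrite EFinM.
  exact/integrableZl/integrable_indic.
rewrite -sumEFin; apply: eq_bigr => i _.
under eq_integral do rewrite EFinM.
rewrite integralZl//; last exact: integrable_indic.
by rewrite integral_indic// setIT EFinM fineK// fin_num_measure.
Qed.

Definition same_bin (T : nat) (B : seq {set 'I_T}) (s t : 'I_T) : bool :=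
  has (fun b : {set 'I_T} => (s \in b) && (t \in b)) B.

Lemma same_bin_refl (T : nat) (B : seq {set 'I_T}) (t : 'I_T) :
  is_binning B -> same_bin B t t.
Proof.
case/andP => _ /eqP; rewrite finset.bigcup_seq => BT.
have := finset.in_setT t; rewrite -BT => /finset.bigcupP[b bB tb].
by apply/hasP; exists b; rewrite ?tb.
Qed.

(** Bins are pairwise disjoint, so at most one entry of [B] contains both [s] and [t], and the count
    is 0 or 1. *)
Lemma sum_same_bin (R : realType) (T : nat) (B : seq {set 'I_T}) (s t : 'I_T) :
  is_binning B ->
  \sum_(b <- B) ((s \in b) && (t \in b))%:R = (same_bin B s t)%:R :> R.
Proof.
case/andP => + _; elim: B => [|b B IH] /=; first by rewrite big_nil.
case/andP => /allP bB /IH {}IH; rewrite big_cons {}IH /same_bin /=.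
case: andP => [[sb tb]|_]; last by rewrite add0r.
suff -> : has (fun b : {set 'I_T} => (s \in b) && (t \in b)) B = false.
  by rewrite addr0.
apply/hasPn => c /bB /eqP bc0; apply/negP => /andP[sc _].
by have := finset.in_set0 s; rewrite -bc0 inE sb sc.
Qed.

Lemma binned_sqerrE (R : realType) (T : nat) (r p : 'I_T -> R)
    (B : seq {set 'I_T}) : is_binning B ->
  binned_sqerr r p B =
  \sum_(st : 'I_T * 'I_T) (T%:R ^+ 2)^-1 *
    ((r st.1 - p st.1) * (r st.2 - p st.2)) * (same_bin B st.1 st.2)%:R.
Proof.
move=> hB; rewrite /binned_sqerr.
under [RHS]eq_bigr do rewrite -(@sum_same_bin R)// mulr_sumr.
rewrite exchange_big /=; apply: eq_bigr => b _.
rewrite /bin_bias exprMn exprVn [X in _ * X]expr2 big_distrlr /=.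
rewrite pair_big_dep /= mulr_sumr [LHS]big_mkcond /=.
by apply: eq_bigr => -[s t] _ /=; case: ifP; rewrite ?(mulr1, mulr0).
Qed.

(* The witness [M s t] is the probability that [s] and [t] fall into the same bin. *)
Lemma UBSE_quadratic (R : realType)
    (CAL : forall T : nat, ('I_T -> R) -> ('I_T -> R) -> R)
    (T : nat) (r : 'I_T -> R) :
  is_UBSE CAL -> (0 < T)%N -> unit_vector r ->
  exists M : 'I_T -> 'I_T -> R, (forall t, M t t = 1) /\
    forall p, unit_vector p -> CAL T r p =
      \sum_(st : 'I_T * 'I_T) (T%:R ^+ 2)^-1 *
        ((r st.1 - p st.1) * (r st.2 - p st.2)) * M st.1 st.2.
Proof.
move=> hCAL T0 hr; have [d [W [P [B [mB hB EB]]]]] := hCAL T r T0 hr.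
(* [B] is fixed before [p], so a single matrix serves all ground truths, including every realization
   of [y]. *)
exists (fun s t => fine (P (B @^-1` [set b | same_bin b s t]))); split.
  move=> t.
  rewrite (_ : _ @^-1` _ = setT) ?probability_setT//.
  by apply/seteqP; split=> w //= _; exact: same_bin_refl.
move=> p hp; apply: EFin_inj; rewrite EB//.
rewrite -(@expectation_sum_indic _ _ _ P _ _
  (fun st => B @^-1` [set b | same_bin b st.1 st.2])); last first.
  by move=> st; exact: mB.
congr expectation; apply/funext => w; rewrite binned_sqerrE//.
apply: eq_bigr => st _; rewrite indicE; congr (_ * (nat_of_bool _)%:R).
by apply/idP/idP; rewrite inE.
Qed.

Section bernoulli_vector_moments.
Context (R : realType) (d : measure_display) (Omega : measurableType d).
Context (P : probability Omega R) (T : nat).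
Context (p : 'I_T -> R) (y : 'I_T -> {RV P >-> bool}).
Hypotheses (hp : unit_vector p) (hy : bernoulli_vector p y).

Let measurable_eq t b : measurable (y t @^-1` [set b]).
Proof. exact: measurable_funPTI. Qed.

Let measurable_pair s t b c : measurable (y s @^-1` [set b] `&` y t @^-1` [set c]).
Proof. exact: measurableI. Qed.

Lemma bernoulli_vector1 t b : P (y t @^-1` [set b]) = (bernoulli_pmf (p t) b)%:E.
Proof.
have := hy.2 t [set b]; rewrite /distribution /pushforward => ->.
(* [bernoulli_prob] is defined by cases on its parameter; [hp] selects the branch given by
   [bernoulli_pmf]. *)
by rewrite /bernoulli_prob hp fsbig_set1.
Qed.

Lemma bernoulli_vector2 s t b c : s != t ->
  P (y s @^-1` [set b] `&` y t @^-1` [set c]) =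
  (bernoulli_pmf (p s) b * bernoulli_pmf (p t) c)%:E.
Proof.
(* Independence is applied to the index set [{s, t}], so the value of [A] at any third index is
   arbitrary. *)
move=> st; pose A i := if i == s then [set b] else [set c].
have := hy.1 [set s; t]%SET A.
rewrite (bigD1 s) ?inE ?eqxx//= (big_pred1 t) => [|i]; last first.
  by rewrite !inE; case: eqVneq => [->|]; rewrite ?(negbTE st)// andbT.
rewrite /A eqxx eq_sym (negbTE st) EFinM -!bernoulli_vector1 => <-.
  congr (P _); apply/seteqP; split=> [w [ws wt] i /=|w /= ys].
    by rewrite !inE => /orP[]/eqP ->; rewrite ?eqxx ?[t == s]eq_sym ?(negbTE st).
  split.
    by have := ys s; rewrite /= !inE !eqxx; apply.
  by have := ys t; rewrite /= !inE eqxx orbT [t == s]eq_sym (negbTE st); apply.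
by move=> i; case: ifP.
Qed.

(** The left side is the mean of the product of two residuals, computed from the joint law of [y s]
    and [y t]. For distinct indices this law factorizes; for equal ones it lives on [b = c], and the
    variance appears. *)
Lemma bernoulli_vector_residual (r : 'I_T -> R) s t :
  \sum_(bc : bool * bool) (r s - bc.1%:R) * (r t - bc.2%:R) *
    fine (P (y s @^-1` [set bc.1] `&` y t @^-1` [set bc.2])) =
  (r s - p s) * (r t - p t) + (s == t)%:R * (p t * (1 - p t)).
Proof.
rewrite -(pair_bigA _ (fun b c : bool => (r s - b%:R) * (r t - c%:R) *
  fine (P (y s @^-1` [set b] `&` y t @^-1` [set c])))) /=.
rewrite !big_bool /=; case: eqVneq => [->|st].
  have y0 b c : b != c -> y t @^-1` [set b] `&` y t @^-1` [set c] = set0.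
    by move=> bc; apply/seteqP; split=> w //= [-> /eqP]; apply/negP.
  rewrite !setIid !y0// !measure0 !bernoulli_vector1 /=; ring.
rewrite !bernoulli_vector2//=; ring.
Qed.

Lemma expectation_quadratic (r : 'I_T -> R) (K : 'I_T * 'I_T -> R) :
  'E_P[fun w => (\sum_st (r st.1 - (y st.1 w)%:R) * (r st.2 - (y st.2 w)%:R)
                * K st)%R]%E =
  (\sum_st ((r st.1 - p st.1) * (r st.2 - p st.2)
     + (st.1 == st.2)%:R * (p st.2 * (1 - p st.2))) * K st)%:E.
Proof.
pose A (x : ('I_T * 'I_T) * (bool * bool)) :=
  y x.1.1 @^-1` [set x.2.1] `&` y x.1.2 @^-1` [set x.2.2].
pose a (x : ('I_T * 'I_T) * (bool * bool)) :=
  (r x.1.1 - x.2.1%:R) * (r x.1.2 - x.2.2%:R) * K x.1.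
transitivity ('E_P[fun w => (\sum_x a x * \1_(A x) w)%R])%E.
  congr expectation; apply/funext => w.
  rewrite -(pair_bigA _ (fun st bc => a (st, bc) * \1_(A (st, bc)) w)) /=.
  (* At a given [w], only the event for the values actually taken by [y s] and [y t] has a nonzero
     indicator. *)
  apply: eq_bigr => -[s t] _ /=; rewrite (bigD1 (y s w, y t w)) //= big1.
    by rewrite addr0 indicE mem_set ?mulr1.
  move=> [b c] /= bc; rewrite indicE memNset ?mulr0//= => -[yb yc].
  by move: bc; rewrite yb yc eqxx.
rewrite expectation_sum_indic; last by move=> x; exact: measurable_pair.
congr _%:E.
rewrite -(pair_bigA _ (fun st bc => a (st, bc) * fine (P (A (st, bc))))) /=.
apply: eq_bigr => -[s t] _ /=; rewrite -bernoulli_vector_residual mulr_suml.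
by apply: eq_bigr => bc _; rewrite /a /A /= mulrAC.
Qed.

End bernoulli_vector_moments.

Unset Implicit Arguments.
Set Strict Implicit.

Theorem lemma3p3 (R : realType)
    (CAL : forall T : nat, ('I_T -> R) -> ('I_T -> R) -> R)
    (hCAL : is_UBSE CAL)
    (T : nat) (hT : (0 < T)%N) (r p : 'I_T -> R)
    (hr : unit_vector r) (hp : unit_vector p)
    (d : measure_display) (Omega : measurableType d)
    (P : probability Omega R) (y : 'I_T -> {RV P >-> bool})
    (hy : bernoulli_vector p y) :
  'E_P[fun w => CAL T r (fun t => (y t w)%:R)]%E =
  (CAL T r p + (T%:R ^+ 2)^-1 * \sum_(t < T) p t * (1 - p t))%:E.
Proof.
have [M [M1 CALE]] := UBSE_quadratic hCAL hT hr.
pose K (st : 'I_T * 'I_T) := (T%:R ^+ 2)^-1 * M st.1 st.2.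
transitivity ('E_P[fun w => (\sum_st (r st.1 - (y st.1 w)%:R) *
    (r st.2 - (y st.2 w)%:R) * K st)%R])%E.
  (* Each realization of [y] is itself a vector in the unit cube, so the quadratic form applies
     pointwise in [w]. *)
  congr expectation; apply/funext => w; rewrite CALE => [|t].
    by apply: eq_bigr => st _; rewrite [_^-1 * _]mulrC -[LHS]mulrA.
  by case: (y t w); rewrite ?lexx ?ler01.
rewrite (expectation_quadratic hp hy) CALE//; congr _%:E.
under eq_bigr do rewrite mulrDl.
rewrite big_split /=; congr (_ + _).
  by apply: eq_bigr => st _; rewrite /K; ring.
rewrite mulr_sumr.
(* Only diagonal terms carry variance, and there [M s s = 1] whatever the law of the partition. *)
rewrite -(pair_bigA _ (fun s t => (s == t)%:R * (p t * (1 - p t)) * K (s, t))) /=.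
apply: eq_bigr => s _; rewrite (bigD1 s)//= big1 => [|t ts].
  by rewrite eqxx /K /= M1 mul1r mulr1 addr0 mulrC.
by rewrite eq_sym (negbTE ts) !mul0r.
Qed.
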